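(* Let $n$ be even and let $z,y$ be skew-symmetric $n\times n$ complex matrices. Then $$\sum_{I\subseteq[n]}\mathrm{Pfaff}(z_I)\,\mathrm{Pfaff}(y_{[n]\setminus I})=\mathrm{Pfaff}(\tilde z+y),$$ i.e. $\langle\mathrm{sPf}(z),\mathrm{sPf}^{\vee}(y)\rangle=\mathrm{Pfaff}(\tilde z+y)$.
   Context: For $I\subseteq[n]$, $z_I$ is the principal submatrix of $z$ with rows and columns indexed by $I$ (in increasing order); $\mathrm{Pfaff}$ of the empty matrix is $1$ and of an odd-size matrix is $0$. $\mathrm{sPf}(z)\in\mathbb{C}^{2^n}$ has coordinates $\mathrm{sPf}(z)_I=\mathrm{Pfaff}(z_I)$, $\mathrm{sPf}^{\vee}(y)_I=\mathrm{Pfaff}(y_{[n]\setminus I})$, and $\langle u,v\rangle=\sum_{I\subseteq[n]}u_Iv_I$. The matrix $\tilde z$ is defined by $\tilde z_{ij}=(-1)^{i+j+1}z_{ij}$. *)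

(* Defs.v *)
From HB Require Import structures.
From mathcomp Require Import all_boot all_order all_algebra all_fingroup.
From mathcomp Require Import sesquilinear complex reals.

Set Implicit Arguments.
Unset Strict Implicit.
Unset Printing Implicit Defensive.

Import Order.TTheory GRing.Theory Num.Theory.
Local Open Scope ring_scope.

Fact pair_fst_subproof (n : nat) (k : 'I_n./2) : (k.*2 < n)%N.
Proof. by apply: ltnW; rewrite -gtn_half_double. Qed.

Fact pair_snd_subproof (n : nat) (k : 'I_n./2) : (k.*2.+1 < n)%N.
Proof. by rewrite -gtn_half_double. Qed.

(* Rows and columns are numbered from 0, so the pairs of consecutive positions
   (1,2), (3,4), ... of the usual notation are here (2k, 2k+1) for k < n./2. *)
Definition pair_fst (n : nat) (k : 'I_n./2) : 'I_n :=
  Ordinal (pair_fst_subproof k).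

Definition pair_snd (n : nat) (k : 'I_n./2) : 'I_n :=
  Ordinal (pair_snd_subproof k).

(* For n = 2m this is
     1 / (2^m m!) * \sum_(s in S_n) sgn(s) \prod_k A_(s(2k), s(2k+1)),
   which gives 1 when n = 0. The argument is meant to be skew-symmetric. *)
Definition Pfaff (F : numFieldType) (n : nat) (A : 'M[F]_n) : F :=
  if odd n then 0
  else (2 ^ n./2 * (n./2)`!)%:R^-1 *
       \sum_(s : 'S_n)
         (-1) ^+ s * \prod_(k < n./2) A (s (pair_fst k)) (s (pair_snd k)).

(* enum_val lists the elements of I in increasing order. *)
Definition psubmx (F : numFieldType) (n : nat) (A : 'M[F]_n) (I : {set 'I_n}) :
    'M[F]_#|I| :=
  mxsub (fun i : 'I_#|I| => enum_val i) (fun j : 'I_#|I| => enum_val j) A.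

(* Vectors of F^(2^n) have their coordinates indexed by the subsets of 'I_n. *)
Definition sPf (F : numFieldType) (n : nat) (z : 'M[F]_n) :
    {ffun {set 'I_n} -> F} :=
  [ffun I => Pfaff (psubmx z I)].

Definition sPf_dual (F : numFieldType) (n : nat) (y : 'M[F]_n) :
    {ffun {set 'I_n} -> F} :=
  [ffun I : {set 'I_n} => Pfaff (psubmx y (~: I))].

Definition pairing (F : numFieldType) (n : nat)
    (u v : {ffun {set 'I_n} -> F}) : F :=
  \sum_(I : {set 'I_n}) u I * v I.

(* The parity of i + j is the same whether indices start at 0 or at 1. *)
Definition tildemx (F : numFieldType) (n : nat) (z : 'M[F]_n) : 'M[F]_n :=
  \matrix_(i < n, j < n) ((-1) ^+ (i + j + 1) * z i j).

(* Main.v *)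
Require Import Defs.
From HB Require Import structures.
From mathcomp Require Import all_boot all_order all_algebra all_fingroup.
From mathcomp Require Import sesquilinear complex reals.
From mathcomp Require Import ring zify.

Import Order.TTheory GRing.Theory Num.Theory.
Local Open Scope ring_scope.

(* Functions on index sequences stand for elements of an exterior algebra.
   Expansion along the first row says that Pf A, read as a function of the
   sequence of selected indices, is the unique P with P [::] = 1 and
   d_x P = a_x /\ P for all x, where a_x is row x of A and
   (d_x P) s = P (x :: s). As d_x is an antiderivation and Pf A is even,
   Pf A /\ Pf B satisfies this recursion for A + B, so it is Pf (A + B). The
   product /\ is a sum over subsets I weighted by the sign of the shuffle
   (I, complement of I), and passing from z to its tilde absorbs that sign. *)

(** * Exterior products of functions on sequences *)

Section Wedge.
Variables (F : comNzRingType) (T : Type).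
Implicit Types (a b : T -> F) (G H K : seq T -> F) (s t : seq T).

(* Exterior product by the function supported on the singletons [:: x],
   with value a x there. *)
Fixpoint wedge1 a G s : F :=
  if s is y :: s' then a y * G s' - wedge1 a (fun t => G (y :: t)) s' else 0.

(* The antiderivation rule d_y (G /\ H) = d_y G /\ H + (-1)^deg G /\ d_y H,
   taken as a definition. *)
Fixpoint wedge G H s : F :=
  if s is y :: s' then
    wedge (fun t => G (y :: t)) H s'
    + wedge (fun t => (-1) ^+ size t * G t) (fun t => H (y :: t)) s'
  else G [::] * H [::].

Fixpoint split_sum G H s : F :=
  if s is y :: s' then
    split_sum (fun t => G (y :: t)) H s' + split_sum G (fun t => H (y :: t)) s'
  else G [::] * H [::].

(** [wedge1] evaluates [G] only at [s] with one entry deleted. Asking for agreement at that length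
    alone permits induction on the length in [Pfaff_seq_unique]. *)
Lemma eq_wedge1 a b G H s : a =1 b ->
  (forall t, (size t).+1 = size s -> G t = H t) -> wedge1 a G s = wedge1 b H s.
Proof.
move=> eqab; elim: s G H => [//|y s IHs] G H eqGH /=.
rewrite eqab eqGH // (IHs _ (fun t => H (y :: t))) // => t ts.
by apply: eqGH; rewrite /= ts.
Qed.

(** The combination is a pointwise hypothesis on [K], so that no functional extensionality is
    needed; [d = 0] gives plain scaling. *)
Lemma wedge1_lin a c d G H K s : (forall t, K t = c * G t + d * H t) ->
  wedge1 a K s = c * wedge1 a G s + d * wedge1 a H s.
Proof.
elim: s G H K => [|y s IHs] G H K defK /=; first by rewrite !mulr0 addr0.
rewrite (IHs (fun t => G (y :: t)) (fun t => H (y :: t))) // defK; ring.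
Qed.

Lemma wedge1D a b G s :
  wedge1 (fun x => a x + b x) G s = wedge1 a G s + wedge1 b G s.
Proof.
by elim: s G => [|y s IHs] G /=; rewrite ?addr0 // IHs; ring.
Qed.

Lemma wedge_linl c d G G1 G2 H H' s : (forall t, G t = c * G1 t + d * G2 t) ->
  H =1 H' -> wedge G H s = c * wedge G1 H' s + d * wedge G2 H' s.
Proof.
elim: s G G1 G2 H H' => [|y s IHs] G G1 G2 H H' defG eqH /=.
  by rewrite defG eqH; ring.
rewrite (IHs (fun t => G (y :: t)) (fun t => G1 (y :: t))
  (fun t => G2 (y :: t)) H H') //.
rewrite (IHs (fun t => (-1) ^+ size t * G t) (fun t => (-1) ^+ size t * G1 t)
   (fun t => (-1) ^+ size t * G2 t) (fun t => H (y :: t)) (fun t => H' (y :: t))) //;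
  first by ring.
by move=> t; rewrite defG; ring.
Qed.

Lemma wedge_linr c d G G' H H1 H2 s : G =1 G' ->
  (forall t, H t = c * H1 t + d * H2 t) ->
  wedge G H s = c * wedge G' H1 s + d * wedge G' H2 s.
Proof.
elim: s G G' H H1 H2 => [|y s IHs] G G' H H1 H2 eqG defH /=.
  by rewrite defH eqG; ring.
rewrite (IHs (fun t => G (y :: t)) (fun t => G' (y :: t)) H H1 H2) //.
rewrite (IHs (fun t => (-1) ^+ size t * G t) (fun t => (-1) ^+ size t * G' t)
  (fun t => H (y :: t)) (fun t => H1 (y :: t)) (fun t => H2 (y :: t))) //;
  first by ring.
by move=> t; rewrite eqG.
Qed.

Lemma eq_wedge G G' H H' s : G =1 G' -> H =1 H' ->
  wedge G H s = wedge G' H' s.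
Proof.
move=> eqG eqH; rewrite (wedge_linl 1 0 _ G' G' _ H') //; first by ring.
by move=> t; rewrite eqG; ring.
Qed.

(** [G] is evaluated one entry below the length of [s], hence the extra minus sign. *)
Lemma wedge1_sign a G s :
  wedge1 a (fun t => (-1) ^+ size t * G t) s
    = - ((-1) ^+ size s * wedge1 a G s).
Proof.
elim: s G => [|y s IHs] G /=; first by rewrite mulr0 oppr0.
rewrite (wedge1_lin _ (-1) 0 (fun t => (-1) ^+ size t * G (y :: t)) G).
  by rewrite IHs exprS; ring.
by move=> t /=; rewrite exprS; ring.
Qed.

(** Both sides have the same d_y, by induction on the sequence; this is associativity of the
    exterior product for a 1-form on the left. *)
Lemma wedge1_wedge a G H s :
  wedge1 a (wedge G H) s = wedge (wedge1 a G) H s.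
Proof.
elim: s G H => [|y s IHs] G H /=; first by rewrite mul0r.
rewrite (wedge1_lin _ 1 1 (wedge (fun t => G (y :: t)) H)
  (wedge (fun t => (-1) ^+ size t * G t) (fun t => H (y :: t)))); last first.
  by move=> t /=; ring.
rewrite !IHs (wedge_linl (a y) (-1)
  (fun t => a y * G t - wedge1 a (fun u => G (y :: u)) t)
  G (wedge1 a (fun t => G (y :: t))) H H) //; last by move=> t; ring.
rewrite (wedge_linl (-1) 0 (fun t => (-1) ^+ size t * wedge1 a G t)
  (wedge1 a (fun t => (-1) ^+ size t * G t)) G
  (fun t => H (y :: t)) (fun t => H (y :: t))) //.
  by ring.
by move=> t; rewrite wedge1_sign; ring.
Qed.

(** Carrying the 1-form [b] leftwards past [G] costs the sign (-1)^deg G. *)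
Lemma wedge_wedge1 b G H s :
  wedge G (wedge1 b H) s = wedge1 b (wedge (fun t => (-1) ^+ size t * G t) H) s.
Proof.
elim: s G H => [|y s IHs] G H /=; first by rewrite mulr0.
rewrite (wedge_linr (b y) (-1) (fun t => (-1) ^+ size t * G t)
  (fun t => (-1) ^+ size t * G t)
  (fun t => b y * H t - wedge1 b (fun u => H (y :: u)) t) H
  (wedge1 b (fun t => H (y :: t)))) //; last by move=> t; ring.
rewrite !IHs.
rewrite (wedge1_lin _ (-1) 1 (wedge (fun t => (-1) ^+ size t * G (y :: t)) H)
  (wedge (fun t => (-1) ^+ size t * ((-1) ^+ size t * G t)) (fun t => H (y :: t)))
  (fun t => _ + _)); first by ring.
move=> t; congr (_ + _); last by rewrite mul1r.
rewrite (wedge_linl (-1) 0 _ (fun t => (-1) ^+ size t * G (y :: t)) G _ H) //.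
  by ring.
by move=> u /=; rewrite exprS; ring.
Qed.

Lemma wedge1E x0 a G s : wedge1 a G s =
  \sum_(j < size s)
    (-1) ^+ j * a (nth x0 s j) * G (take j s ++ drop j.+1 s).
Proof.
elim: s G => [|y s IHs] G /=; first by rewrite big_ord0.
rewrite big_ord_recl /= drop0 expr0 mul1r IHs -sumrN; congr (_ + _).
by apply: eq_bigr => j _; rewrite /= /bump /= add1n exprS; ring.
Qed.

(** Every term of [wedge1] uses each entry of [s] exactly once, so the factors [c] gather into the
    same product in all terms. *)
Lemma wedge1_scale a (c : T -> F) d e G s :
  wedge1 (fun y => d * c y * a y) (fun t => e * (\prod_(x <- t) c x) * G t) s
    = d * e * (\prod_(x <- s) c x) * wedge1 a G s.
Proof.
elim: s G => [|y s IHs] G /=; first by rewrite mulr0.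
rewrite (wedge1_lin _ (c y) 0 (fun t => e * (\prod_(x <- t) c x) * G (y :: t)) G).
  by rewrite IHs big_cons; ring.
by move=> t; rewrite big_cons; ring.
Qed.

(* If the labels v of the ambient sequence are 0, 1, 2, ..., this is the sign of
   the permutation moving the subsequence s to the front: its k-th element
   jumps over (v s_k - k) others, and the k sum to a binomial coefficient. *)
Definition shuffle_sign (v : T -> nat) s : F :=
  (-1) ^+ 'C(size s, 2) * \prod_(x <- s) (-1) ^+ v x.

(** The induction drops heads, so the labels start at a general [k]. The sum [v x + k] has the
    parity of the relative label [v x - k] and avoids truncated subtraction. *)
Lemma wedge_split_sum (v : T -> nat) k G H s : map v s = iota k (size s) ->
  wedge (fun t => shuffle_sign (fun x => (v x + k)%N) t * G t) H s = split_sum G H s.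
Proof.
have shiftS k' t : \prod_(x <- t) (-1) ^+ (v x + k'.+1)
      = (-1) ^+ size t * \prod_(x <- t) (-1) ^+ (v x + k') :> F.
  by elim: t => [|x t IHt]; rewrite ?big_nil ?mulr1 // !big_cons IHt addnS !exprS; ring.
elim: s k G H => [|y s IHs] k G H /=.
  by move=> _; rewrite /shuffle_sign big_nil !mul1r.
case=> vy vs; rewrite -!(IHs k.+1) //; congr (_ + _); apply: eq_wedge => // t.
  (* When [y] goes to [G], its own sign is (-1)^(2k) = 1, and the (-1)^(size t) from Pascal's rule
     accounts for the shift of all labels from [k] to [k.+1]. *)
  rewrite /shuffle_sign big_cons /= shiftS binS bin1 vy addnn -mul2n exprM sqrrN.
  by rewrite !expr1n exprD; ring.
(* When [y] goes to [H], the same shift accounts for the degree sign in [wedge]. *)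
by rewrite /shuffle_sign shiftS; ring.
Qed.

End Wedge.

Arguments wedge1 {F T}.
Arguments wedge {F T}.
Arguments split_sum {F T}.
Arguments shuffle_sign {F T}.

Lemma split_sum_set (F : comNzRingType) (T : finType) (G H : seq T -> F) s :
  uniq s ->
  split_sum G H s = \sum_(I : {set T} | I \subset [set x in s])
     G [seq x <- s | x \in I] * H [seq x <- s | x \notin I].
Proof.
elim: s G H => [|y s IHs] G H /=.
  move=> _; rewrite (big_pred1 set0) // => I.
  by rewrite /= -subset0; congr (_ \subset _); apply/setP=> x; rewrite !inE.
case/andP=> ys us; rewrite !IHs // [RHS](bigID (fun I : {set T} => y \in I)) /=.
have sub1 (I : {set T}) : I \subset [set x in s] -> y \notin I.
  by move=> sIs; apply: contra ys => /(subsetP sIs); rewrite inE.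
congr (_ + _); last first.
  apply: eq_big => [I|I sIs]; last by rewrite (negbTE (sub1 _ sIs)).
  apply/idP/andP=> [sIs|[sIs yI]].
    split; last exact: sub1.
    by apply: subset_trans sIs _; apply/subsetP=> x; rewrite !inE => ->; rewrite orbT.
  apply/subsetP=> x xI; have := subsetP sIs x xI; rewrite !inE => /predU1P[xy|//].
  by rewrite -xy xI in yI.
(* Subsets containing [y] correspond to subsets of the tail by removing and adding [y]. *)
rewrite [RHS](reindex_onto (fun I => y |: I) (fun I => I :\ y)) /=; last first.
  by move=> I /andP[_]; apply: setD1K.
apply: eq_big => [I|I sIs].
  rewrite setU11 andbT; apply/idP/andP=> [sIs|[sIs /eqP eqI]].
    split; last by rewrite setU1K // sub1.
    apply/subsetP=> x; rewrite !inE => /predU1P[->|/(subsetP sIs)]; rewrite ?eqxx //.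
    by rewrite inE orbC => ->.
  apply/subsetP=> x; rewrite -eqI !inE => /andP[nxy].
  rewrite (negbTE nxy) /= => xI.
  by have := subsetP sIs x; rewrite !inE (negbTE nxy) xI; apply.
rewrite setU11 /=; congr (G (_ :: _) * H _); apply: eq_in_filter => x xs.
  by rewrite !inE; case: eqP => // xy; rewrite -xy xs in ys.
by rewrite !inE; case: eqP => // xy; rewrite -xy xs in ys.
Qed.

(** * Expansion of a Pfaffian along its first row *)

Lemma sum_perm_fix (V : nmodType) n (i j : 'I_n.+1) (E : 'S_n.+1 -> V) :
  \sum_(s : 'S_n.+1 | s i == j) E s = \sum_(s : 'S_n) E (lift_perm i j s).
Proof.
rewrite (reindex (lift_perm i j)) /=; last first.
  (* The inverse of [lift_perm i j] deletes [i] from the source and [s i] from the target. The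
     default [k] is never taken, as [s (lift i k)] differs from [s i]. *)
  have inj_res (s : 'S_n.+1) : injective (fun k => odflt k (unlift (s i) (s (lift i k)))).
    move=> k1 k2; have lift_s k : {l | s (lift i k) = lift (s i) l}.
      have /unlift_some[l ->] : s i != s (lift i k); last by exists l.
      by rewrite (inj_eq perm_inj) neq_lift.
    have [[l1 e1] [l2 e2]] := (lift_s k1, lift_s k2).
    rewrite e1 e2 !liftK /= => l12; apply: (@lift_inj _ i); apply: (@perm_inj _ s).
    by rewrite e1 e2 l12.
  exists (fun s => perm (inj_res s)) => [s _ | s].
    by apply/permP=> k; rewrite permE lift_perm_lift lift_perm_id liftK.
  move/eqP=> si; apply/permP=> k; case: (unliftP i k) => [l|] ->.
    rewrite lift_perm_lift permE -si.
    have /unlift_some[m -> ->] // : s i != s (lift i l).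
    by rewrite (inj_eq perm_inj) neq_lift.
  by rewrite lift_perm_id.
by apply: eq_bigl => s; rewrite lift_perm_id eqxx.
Qed.

Section Expand.
Variable F : numFieldType.

Lemma Pfaff_cast n n' (e : n = n') (A : 'M[F]_n) (B : 'M[F]_n') :
  (forall i j, A i j = B (cast_ord e i) (cast_ord e j)) -> Pfaff A = Pfaff B.
Proof.
case: n' / e B => B AB; congr Pfaff; apply/matrixP=> i j.
by rewrite AB !cast_ord_id.
Qed.

Definition pf_term n (A : 'M[F]_n) (s : 'S_n) : F :=
  (-1) ^+ s * \prod_(k < n./2) A (s (pair_fst k)) (s (pair_snd k)).

Arguments pf_term {n}.

Lemma pair_fst_inj n : injective (@pair_fst n).
Proof. by move=> k l /(congr1 val) /= /double_inj /val_inj. Qed.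

Lemma pair_snd_inj n : injective (@pair_snd n).
Proof. by move=> k l /(congr1 val) /= [] /double_inj /val_inj. Qed.

Lemma pair_fst_snd n (k l : 'I_n./2) : (pair_fst k == pair_snd l) = false.
Proof.
by apply/negP=> /eqP /(congr1 (odd \o val)) /=; rewrite !odd_double.
Qed.

(** The two transpositions have equal parity, so the sign is unchanged, and the factors of the
    product are only permuted. *)
Lemma pf_term_swap_pairs n (A : 'M[F]_n) (k l : 'I_n./2) (s : 'S_n) :
  pf_term A (tperm (pair_fst k) (pair_fst l) * tperm (pair_snd k) (pair_snd l) * s)
    = pf_term A s.
Proof.
rewrite /pf_term !odd_permM !odd_tperm (inj_eq (@pair_fst_inj n)).
rewrite (inj_eq (@pair_snd_inj n)) addbb addFb; congr (_ * _).
rewrite [RHS](reindex_inj (@perm_inj _ (tperm k l))) /=.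
apply: eq_bigr => m _; rewrite !permM; congr (A (s _) (s _)).
  by rewrite -(inj_tperm _ _ _ (@pair_fst_inj n)) (@tpermD _ (pair_snd k)) //
    eq_sym pair_fst_snd.
rewrite (inj_tperm _ _ _ (@pair_snd_inj n)).
by rewrite (@tpermD _ (pair_fst k)) // pair_fst_snd.
Qed.

(** The sign of the transposition cancels against the skew-symmetry of one factor. *)
Lemma pf_term_swap n (A : 'M[F]_n) (k : 'I_n./2) (s : 'S_n) :
  (forall i j, A i j = - A j i) ->
  pf_term A (tperm (pair_fst k) (pair_snd k) * s) = pf_term A s.
Proof.
move=> skA; rewrite /pf_term odd_permM odd_tperm pair_fst_snd /= (bigD1 k) //=.
rewrite [in RHS](bigD1 k) //= !permM tpermL tpermR skA signrN !mulNr mulrN opprK.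
congr (_ * (_ * _)); apply: eq_bigr => l lk; rewrite !permM !tpermD //.
all: rewrite ?(inj_eq (@pair_fst_inj n)) ?(inj_eq (@pair_snd_inj n)) ?pair_fst_snd //.
all: by rewrite eq_sym ?pair_fst_snd.
Qed.

Lemma Pfaff_expand n (A : 'M[F]_n.+2) : (forall i j, A i j = - A j i) ->
  Pfaff A = \sum_(j < n.+1) (-1) ^+ j * A ord0 (lift ord0 j) *
    Pfaff (mxsub (fun i => lift ord0 (lift j i)) (fun i => lift ord0 (lift j i)) A).
Proof.
move=> skA; rewrite /Pfaff /= negbK; case: ifP => [_|on].
  by rewrite big1 // => j _; rewrite mulr0.
pose k0 : 'I_n.+2./2 := ord0.
have f0 : pair_fst k0 = ord0 by apply: val_inj.
have s0 : pair_snd k0 = lift ord0 ord0 by apply: val_inj.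
pose S := \sum_(s : 'S_n.+2 | s ord0 == ord0) pf_term A s.
(* Reordering the pairs and swapping within a pair leave pf_term unchanged, so
   the position that s sends to 0 may be taken to be 0. *)
have Sfst k : \sum_(s : 'S_n.+2 | s (pair_fst k) == ord0) pf_term A s = S.
  rewrite (reindex_inj (mulgI (tperm (pair_fst k0) (pair_fst k) *
    tperm (pair_snd k0) (pair_snd k))%g)).
  apply: eq_big => [s|s _]; last exact: pf_term_swap_pairs.
  by rewrite !permM tpermR tpermD ?f0 // -f0 eq_sym pair_fst_snd.
have Ssnd k : \sum_(s : 'S_n.+2 | s (pair_snd k) == ord0) pf_term A s = S.
  rewrite -(Sfst k) (reindex_inj (mulgI (tperm (pair_fst k) (pair_snd k)))).
  by apply: eq_big => [s|s _]; [rewrite permM tpermR | apply: pf_term_swap].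
have sumS : \sum_(s : 'S_n.+2) pf_term A s = n.+2%:R * S.
  rewrite (partition_big (fun s : 'S_n.+2 => (s^-1)%g ord0) predT) //=.
  rewrite (eq_bigr (fun=> S)) ?sumr_const ?card_ord ?mulr_natl // => i _.
  rewrite (eq_bigl (fun s : 'S_n.+2 => s i == ord0)); last first.
    by move=> s; rewrite -(inj_eq (@perm_inj _ s)) permKV eq_sym.
  have ik : (i./2 < n.+2./2)%N by have := ltn_ord i; lia.
  case io: (odd i); [rewrite -(Ssnd (Ordinal ik)) | rewrite -(Sfst (Ordinal ik))].
    by apply: eq_bigl => s; congr (s _ == _); apply: val_inj => /=; lia.
  by apply: eq_bigl => s; congr (s _ == _); apply: val_inj => /=; lia.
rewrite [X in _ * X]sumS /S sum_perm_fix.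
(* Position 0 now holds index 0. The sum is split by the index [lift ord0 j] paired with it; fixing
   this index through [lift_perm] produces the sign (-1)^j. *)
rewrite (partition_big (fun s : 'S_n.+1 => s ord0) predT) //=.
rewrite mulrA mulr_sumr; apply: eq_bigr => j _.
rewrite sum_perm_fix !mulr_sumr; apply: eq_bigr => s _.
rewrite /pf_term (big_ord_recl n./2) !odd_lift_perm /= f0 s0 !lift_perm_id.
rewrite lift_perm_lift lift_perm_id signr_addb signr_odd.
rewrite (eq_bigr (fun k : 'I_n./2 => mxsub (fun i => lift ord0 (lift j i))
    (fun i => lift ord0 (lift j i)) A (s (pair_fst k)) (s (pair_snd k)))); last first.
  move=> k _; rewrite mxE; congr (A _ _).
    rewrite (_ : pair_fst _ = lift ord0 (lift ord0 (pair_fst k))) ?lift_perm_lift //.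
    exact: val_inj.
  rewrite (_ : pair_snd _ = lift ord0 (lift ord0 (pair_snd k))) ?lift_perm_lift //.
  exact: val_inj.
(* As [n] is even, n + 2 = 2 (n/2 + 1) cancels one factor 2 and the top factor of the factorial. *)
have -> : (2 ^ n./2.+1 * (n./2.+1)`!)%:R^-1 * n.+2%:R = (2 ^ n./2 * (n./2)`!)%:R^-1 :> F.
  have -> : n.+2 = (2 * n./2.+1)%N by lia.
  rewrite factS expnS mulnACA natrM invfM mulrAC mulVf ?mul1r //.
  by rewrite pnatr_eq0.
move: (_%:R^-1) (\prod_(k < _) _) (A _ _) ((-1) ^+ j) ((-1) ^+ s) => c p u e1 e2.
by ring.
Qed.

End Expand.

(** * Pfaffians of sequences of indices *)

Section ListPfaffian.
Variables (F : numFieldType) (T : Type).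
Implicit Types (A B : T -> T -> F) (s t : seq T).

(** Sequences of labels keep the dimension out of the types, and deleting an index becomes an
    operation on sequences. *)
Definition Pfaff_seq A s : F :=
  Pfaff (\matrix_(i, j < size s) A (tnth (in_tuple s) i) (tnth (in_tuple s) j)).

Lemma Pfaff_seq_nil A : Pfaff_seq A [::] = 1.
Proof.
rewrite /Pfaff_seq /Pfaff /= muln1 invr1 mul1r (eq_bigr (fun=> 1)) => [|s _].
  by rewrite sumr_const card_Sn.
have -> : s = 1%g by apply/permP=> - [].
by rewrite odd_perm1 big_ord0 mulr1.
Qed.

Lemma Pfaff_seq_odd A s : odd (size s) -> Pfaff_seq A s = 0.
Proof. by rewrite /Pfaff_seq /Pfaff => ->. Qed.

Lemma Pfaff_seq_sign A t : (-1) ^+ size t * Pfaff_seq A t = Pfaff_seq A t.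
Proof.
case ot: (odd (size t)); first by rewrite Pfaff_seq_odd // mulr0.
by rewrite -signr_odd ot mul1r.
Qed.

Lemma Pfaff_seq_cons A x s : (forall u v, A u v = - A v u) ->
  Pfaff_seq A (x :: s) = wedge1 (A x) (Pfaff_seq A) s.
Proof.
case: s => [|y s] skA; first by rewrite Pfaff_seq_odd.
rewrite /Pfaff_seq Pfaff_expand => [|i j]; last by rewrite !mxE.
rewrite (wedge1E _ _ x); apply: eq_bigr => j _; rewrite mxE.
rewrite !(tnth_nth x) /=; congr (_ * _).
set s' := _ ++ _; have sz : size s = size s'.
  have /= j_lt := ltn_ord j.
  by rewrite size_cat size_takel ?size_drop /= ?subnSK ?subnKC // ltnW.
apply: (Pfaff_cast _ _ _ sz) => i k; rewrite !mxE !(tnth_nth x) /=.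
have nthE (l : 'I_(size s)) : nth x (y :: s) (bump j l) = nth x s' l.
  rewrite /s' nth_cat size_takel; last by rewrite ltnW.
  rewrite /bump; case: ltnP => lj; first by rewrite nth_take //.
  by rewrite nth_drop subnKC.
by rewrite !nthE.
Qed.

Lemma Pfaff_seq_unique (P : seq T -> F) A : (forall u v, A u v = - A v u) ->
  P [::] = 1 -> (forall x s, P (x :: s) = wedge1 (A x) P s) -> P =1 Pfaff_seq A.
Proof.
(* The induction is on the length, because [wedge1] evaluates [P] at subsequences that need not be
   tails. *)
move=> skA P0 PS s; have [n] := ubnP (size s); elim: n s => // n IHn [|x s] lt_sn.
  by rewrite P0 Pfaff_seq_nil.
rewrite PS Pfaff_seq_cons //; apply: eq_wedge1 => // t ts; apply: IHn.
by rewrite /= in lt_sn; lia.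
Qed.

Lemma Pfaff_seqD A B :
  (forall u v, A u v = - A v u) -> (forall u v, B u v = - B v u) ->
  wedge (Pfaff_seq A) (Pfaff_seq B) =1 Pfaff_seq (fun u v => A u v + B u v).
Proof.
move=> skA skB; apply: Pfaff_seq_unique => [u v||x s] /=.
- by rewrite skA skB opprD.
- by rewrite !Pfaff_seq_nil mulr1.
rewrite wedge1D !wedge1_wedge; congr (_ + _).
  by apply: eq_wedge => // t; rewrite Pfaff_seq_cons.
(* One degree sign comes from the antiderivation rule, another from moving [B x] past [Pfaff_seq A];
   both disappear because that function vanishes at odd lengths. *)
rewrite -[RHS]wedge1_wedge.
rewrite (eq_wedge _ _ _ (fun t => (-1) ^+ size t * Pfaff_seq A t) _
  (wedge1 (B x) (Pfaff_seq B))) //.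
  rewrite wedge_wedge1; apply: eq_wedge1 => // t _; apply: eq_wedge => // u.
  by rewrite !Pfaff_seq_sign.
by move=> t; rewrite Pfaff_seq_cons.
Qed.

(** At length 2m, scaling rows and columns by (-1)^v yields the product of these signs, and the
    remaining factor -1 on all entries yields (-1)^m. This agrees with the binomial sign, as C(2m,
    2) = m (2m - 1). *)
Lemma Pfaff_seq_tilde A (v : T -> nat) t : (forall u v, A u v = - A v u) ->
  Pfaff_seq (fun x y => (-1) ^+ (v x + v y + 1) * A x y) t
    = shuffle_sign v t * Pfaff_seq A t.
Proof.
move=> skA; symmetry; move: t; apply: Pfaff_seq_unique => [x y||x s].
- by rewrite skA (addnC (v x)); ring.
- by rewrite /shuffle_sign big_nil Pfaff_seq_nil !mul1r.
rewrite Pfaff_seq_cons //.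
case: s => [|y s]; first by rewrite /= mulr0.
transitivity (wedge1 (fun u => - (-1) ^+ v x * (-1) ^+ v u * A x u)
  (fun t => (-1) ^+ 'C(size s, 2) * \prod_(u <- t) (-1) ^+ v u * Pfaff_seq A t) (y :: s)).
  rewrite (wedge1_scale _ _ _ (fun u => (-1) ^+ v u)) /shuffle_sign big_cons.
  (* With m the size of [s], C(m + 2, 2) = C(m, 2) + 2m + 1; the odd difference matches the minus
     sign of the scaled row. *)
  rewrite /= !binS !bin1 bin0 !exprD expr1; set k := (-1) ^+ size s.
  have k2 : k * k = 1 by rewrite -expr2 sqrr_sign.
  by ring: k2.
apply: eq_wedge1 => [u|t [ts]]; last by rewrite -ts.
by rewrite !exprD expr1; ring.
Qed.

End ListPfaffian.

Arguments Pfaff_seq {F T}.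

(** * The pairing of the two vectors of sub-Pfaffians *)

Theorem theorem4p3 (R : realType) (n : nat) (z y : 'M[R[i]]_n)
    (n_even : ~~ odd n) (z_skew : z \is skewmx) (y_skew : y \is skewmx) :
  \sum_(I : {set 'I_n}) Pfaff (psubmx z I) * Pfaff (psubmx y (~: I))
    = Pfaff (tildemx z + y)
  /\ pairing (sPf z) (sPf_dual y) = Pfaff (tildemx z + y).
Proof.
have skewE (A : 'M[R[i]]_n) : A \is skewmx -> forall i j, A i j = - A j i.
  move=> /is_hermitianmxP skA i j; rewrite {1}skA.
  by rewrite !mxE /= expr1 mulN1r.
have enumI (A : 'M[R[i]]_n) I : Pfaff (psubmx A I) = Pfaff_seq A (enum I).
  apply: (Pfaff_cast _ _ _ (cardE I)) => i j; rewrite !mxE.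
  rewrite /enum_val !(tnth_nth (enum_default i)) /=; congr (A _ _).
  by apply: set_nth_default; rewrite -cardE.
have allE (A : 'M[R[i]]_n) : Pfaff A = Pfaff_seq A (enum 'I_n).
  apply: (Pfaff_cast _ _ _ (esym (size_enum_ord n))) => i j; rewrite !mxE.
  by rewrite !(tnth_nth i) /= !nth_ord_enum.
suff main : \sum_(I : {set 'I_n}) Pfaff (psubmx z I) * Pfaff (psubmx y (~: I))
    = Pfaff (tildemx z + y).
  by split=> //; rewrite -main; apply: eq_bigr => I _; rewrite !ffunE.
have [skz sky] := (skewE _ z_skew, skewE _ y_skew).
transitivity (split_sum (Pfaff_seq z) (Pfaff_seq y) (enum 'I_n)).
  rewrite split_sum_set ?enum_uniq //; apply: eq_big => [I|I _].
    by apply/esym/subsetP=> x; rewrite inE mem_enum.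
  have filterE (J : {set 'I_n}) : [seq x <- enum 'I_n | x \in J] = enum J.
    by rewrite {2}/enum_mem -enumT.
  rewrite !enumI filterE -(filterE (~: I)); congr (_ * Pfaff_seq y _).
  by apply: eq_filter => x; rewrite inE.
(* The ordinals in [enum 'I_n] carry the labels 0, ..., n - 1, so the unsigned sum is an exterior
   product once the shuffle sign is attached to the factor of [z]. *)
rewrite -(wedge_split_sum _ _ val 0); last by rewrite size_enum_ord val_enum_ord.
rewrite allE.
pose tz (i j : 'I_n) := (-1) ^+ (i + j + 1) * z i j.
transitivity (wedge (Pfaff_seq tz) (Pfaff_seq y) (enum 'I_n)).
  apply: eq_wedge => // t; rewrite (Pfaff_seq_tilde _ _ _ val) //.
  by congr (_ * _ * _); apply: eq_bigr => x _; rewrite addn0.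
rewrite Pfaff_seqD //.
  by congr Pfaff; apply/matrixP=> i j; rewrite !mxE.
by move=> i j; rewrite /tz skz (addnC i) mulrN.
Qed.
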